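(* Let $L\ge 2$ and let $S=(d,N_1,\dots,N_L)$ be a neural network architecture. Let $\Omega\subset\mathbb{R}^d$ have non-empty interior, and let $\varrho:\mathbb{R}\to\mathbb{R}$ be locally Lipschitz continuous. If the set $\mathcal{RNN}_\varrho^\Omega(S)$ is convex, then $\varrho$ is a polynomial.
   Context: A neural network with architecture $S=(N_0,N_1,\dots,N_L)$ (with $N_0=d$ the input dimension) is a family $\Phi=((A_\ell,b_\ell))_{\ell=1}^L$ with $A_\ell\in\mathbb{R}^{N_\ell\times N_{\ell-1}}$, $b_\ell\in\mathbb{R}^{N_\ell}$; $\mathcal{NN}(S)$ denotes the set of all such networks. For an activation function $\varrho:\mathbb{R}\to\mathbb{R}$ and $\Omega\subset\mathbb{R}^d$, the realization $\mathrm{R}_\varrho^\Omega(\Phi):\Omega\to\mathbb{R}^{N_L}$ is $x\mapsto x_L$, where $x_0=x$, $x_\ell=\varrho(A_\ell x_{\ell-1}+b_\ell)$ for $\ell=1,\dots,L-1$ ($\varrho$ acting componentwise), and $x_L=A_Lx_{L-1}+b_L$. Further $\mathcal{RNN}_\varrho^\Omega(S)=\{\mathrm{R}_\varrho^\Omega(\Phi):\Phi\in\mathcal{NN}(S)\}$. *)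

(* Defs.v *)
From HB Require Import structures.
From mathcomp Require Import all_boot all_order all_algebra.
From mathcomp Require Export reals.
Set Implicit Arguments. Unset Strict Implicit. Unset Printing Implicit Defensive.
Import Order.TTheory GRing.Theory Num.Theory.
Local Open Scope ring_scope.

(* An architecture S = (N 0, N 1, ..., N L) with d = N 0 is encoded by
   L : nat and N : nat -> nat (values of N beyond L are irrelevant).
   A network is a family of pairs (A_{l+1}, b_{l+1}) with
   A_{l+1} : 'M_(N (l+1), N l) and b_{l+1} : 'cV_(N (l+1)); it is given as a
   nat-indexed family, of which only the entries l < L are used by the
   realization (so the set of realizations is exactly RNN(S)). *)
Definition network (R : realType) (N : nat -> nat) :=
  forall l : nat, 'M[R]_(N l.+1, N l) * 'cV[R]_(N l.+1).

Fixpoint hidden (R : realType) (N : nat -> nat) (rho : R -> R)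
    (Phi : network R N) (x : 'cV[R]_(N 0%N)) (k : nat) : 'cV[R]_(N k) :=
  match k as k0 return 'cV[R]_(N k0) with
  | 0 => x
  | k'.+1 => map_mx rho ((Phi k').1 *m hidden rho Phi x k' + (Phi k').2)
  end.

Definition realization (R : realType) (N : nat -> nat) (L : nat) (rho : R -> R)
    (Phi : network R N) (x : 'cV[R]_(N 0%N)) : 'cV[R]_(N L) :=
  match L as L0 return 'cV[R]_(N L0) with
  | 0 => x
  | L'.+1 => (Phi L').1 *m hidden rho Phi x L' + (Phi L').2
  end.

Arguments realization {R N} L rho Phi x.

Definition in_RNN (R : realType) (N : nat -> nat) (L : nat) (rho : R -> R)
    (Omega : 'cV[R]_(N 0%N) -> Prop) (g : 'cV[R]_(N 0%N) -> 'cV[R]_(N L)) : Prop :=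
  exists Phi : network R N, forall x, Omega x -> g x = realization L rho Phi x.

Arguments in_RNN {R N} L rho Omega g.

Definition RNN_convex (R : realType) (N : nat -> nat) (L : nat) (rho : R -> R)
    (Omega : 'cV[R]_(N 0%N) -> Prop) : Prop :=
  forall (g1 g2 : 'cV[R]_(N 0%N) -> 'cV[R]_(N L)) (t : R),
    in_RNN L rho Omega g1 -> in_RNN L rho Omega g2 -> 0 <= t <= 1 ->
    in_RNN L rho Omega (fun x => t *: g1 x + (1 - t) *: g2 x).

Arguments RNN_convex {R N} L rho Omega.

Definition nonempty_interior (R : realType) (d : nat) (Omega : 'cV[R]_d -> Prop) :=
  exists (x0 : 'cV[R]_d) (r : R), 0 < r /\
    forall y : 'cV[R]_d, (forall i, `|y i 0 - x0 i 0| < r) -> Omega y.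

Definition locally_lipschitz (R : realType) (rho : R -> R) : Prop :=
  forall x : R, exists r : R, exists C : R, 0 < r /\
    forall y z : R, `|y - x| < r -> `|z - x| < r -> `|rho y - rho z| <= C * `|y - z|.

Definition is_polynomial (R : realType) (rho : R -> R) : Prop :=
  exists p : {poly R}, forall x : R, rho x = p.[x].

(* Main.v *)
(* Convexity and scaling of the last layer make RNN(S) a linear space.  Its
   dimension is at most the number P of parameters: on n > P points where n
   realizations are independent, the realization map would be a locally
   Lipschitz surjection from R^P onto R^n, which a pigeonhole argument on nested
   cubes excludes.  Restricting networks to one neuron per layer, the functions
   s |-> rho (a * u s + b), with u a fixed nonconstant chain of the first layers,
   span a space of dimension at most P; since u takes all values of an interval
   and a, b are arbitrary, so do the functions y |-> rho (a * y + b) on R.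
   On this affine-invariant space the translation by t is conjugate, through
   dilations, to all translations by t' <> 0; by continuity its characteristic
   polynomial is that of the identity.  So translations are unipotent, rho is
   polynomial along every arithmetic progression, and continuity concludes. *)
Require Import Defs.
From mathcomp Require Import all_boot all_order all_algebra.
From mathcomp Require Import boolp classical_sets reals topology normedtype derive.
From mathcomp Require Import ring lra zify.
Set Implicit Arguments. Unset Strict Implicit. Unset Printing Implicit Defensive.
Import Order.TTheory GRing.Theory Num.Theory.
Import numFieldNormedType.Exports.
Local Open Scope ring_scope.

(** * Locally Lipschitz maps do not raise dimension *)

Section NoSurjection.
Variables (R : realType) (X : Type) (I : finType) (n : nat).
Variables (coord : X -> I -> R) (F : X -> 'I_n -> R).

(** A sup-norm estimate, with [d] as an upper bound so that no maximum has to be formed; as for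
    locally Lipschitz maps, [K] may grow with the cube. *)
Definition lipschitz_on_boxes := forall M : R, 0 <= M -> exists K : R,
  forall p q (d : R), 0 <= d ->
  (forall i, `|coord p i| <= M) -> (forall i, `|coord q i| <= M) ->
  (forall i, `|coord p i - coord q i| <= d) ->
  forall j, `|F p j - F q j| <= K * d.

Definition misses_box (M : R) (B : ('I_n -> R) * R) := forall p,
  (forall i, `|coord p i| <= M) -> exists j, `|F p j - B.1 j| > B.2.

(** Rounding down sends [x = M] to index [m.+1], hence the [m.+2] grid points. *)
Lemma grid_cell (M : R) (m : nat) (x : R) : 0 < M -> `|x| <= M ->
  exists k : 'I_m.+1.+1, `|x - (k%:R * (2 * M / m.+1%:R) - M)| <= 2 * M / m.+1%:R.
Proof.
move=> M0 xM; set h := 2 * M / m.+1%:R.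
have h0 : 0 < h by rewrite divr_gt0 ?mulr_gt0 ?ltr0n.
have y0 : 0 <= (x + M) / h.
  by apply: divr_ge0 (ltW h0); move: xM; rewrite ler_norml; lra.
have /andP[k1 k2] := truncn_itv y0.
have k3 : (Num.truncn ((x + M) / h) < m.+2)%N.
  rewrite ltnS -(@ler_nat R) (le_trans k1)// ler_pdivrMr//.
  rewrite /h mulrCA divff ?pnatr_eq0// mulr1.
  by move: xM; rewrite ler_norml; lra.
exists (Ordinal k3) => /=; move: k1 k2.
rewrite ler_pdivlMr// ltr_pdivrMr//; set k := Num.truncn _.
rewrite -[k.+1]addn1 natrD mulrDl mul1r => k1 k2.
by rewrite ler_norml; apply/andP; split; lra.
Qed.

(** Pigeonhole: suppose each of m^n small boxes inside [B] met the image of the cube. Points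
    assigned to the same grid point have images too close for two different boxes, so m^n <= (D m +
    1)^|I|, which fails for large m because |I| < n. *)
Lemma misses_subbox (M : R) (B : ('I_n -> R) * R) :
  lipschitz_on_boxes -> (#|I| < n)%N -> 0 < M -> 0 < B.2 ->
  exists B' : ('I_n -> R) * R, [/\ 0 < B'.2,
    forall j, B.1 j - B.2 <= B'.1 j - B'.2 /\ B'.1 j + B'.2 <= B.1 j + B.2
    & misses_box M B'].
Proof.
case: B => c r /= lipF In M0 r0.
have [K KP] := lipF M (ltW M0).
have {KP} [K1 [K10 KP]] : exists K1, 0 < K1 /\ forall p q (d : R), 0 <= d ->
  (forall i, `|coord p i| <= M) -> (forall i, `|coord q i| <= M) ->
  (forall i, `|coord p i - coord q i| <= d) ->
  forall j, `|F p j - F q j| <= K1 * d.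
  exists (`|K| + 1); split; first by rewrite ltr_wpDl.
  move=> p q d d0 pM qM pq j; apply: le_trans (KP p q d d0 pM qM pq j) _.
  by apply: ler_wpM2r => //; move: (ler_norm K); lra.
(* Whatever [m] is, points assigned to the same grid point differ by at most 4M/(Dm) in each
   coordinate; this [D] makes their images differ by less than r/(2m). *)
have [D [D0 DP]] : exists D, (0 < D)%N /\ K1 * (4 * M) * 2 / r < D%:R.
  by exists (Num.truncn (K1 * (4 * M) * 2 / r)).+1; rewrite truncnS_gt.
have DR0 : D%:R != 0 :> R by rewrite pnatr_eq0 -lt0n.
(* D.*2 leaves room for the extra grid points of [grid_cell]. *)
have [m mE] : exists m, m = ((D.*2 ^ #|I|).+1)%N by eexists.
have m0 : (0 < m)%N by rewrite mE.
pose a (k : {ffun 'I_n -> 'I_m}) (j : 'I_n) : R := c j + r * ((k j)%:R / m%:R).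
(* A quarter of the spacing r/m of the centres, so that 2e + r/(2m) is exactly the spacing. *)
pose e := r / (4 * m%:R).
have mR0 : 0 < m%:R :> R by rewrite ltr0n.
have mR1 := lt0r_neq0 mR0.
have e0 : 0 < e by rewrite divr_gt0 ?mulr_gt0.
apply: contrapT => noB.
have hit (k : {ffun 'I_n -> 'I_m}) : exists p,
    (forall i, `|coord p i| <= M) /\ forall j, `|F p j - a k j| <= e.
  apply: contrapT => nok; apply: noB; exists (a k, e); split => //=.
    move=> j; rewrite /a; split.
      rewrite -addrA lerD2l; apply: (@le_trans _ _ (-e)).
        rewrite lerN2 /e ler_pdivrMr ?mulr_gt0// ler_peMr//; first exact: ltW.
        have : 1 <= m%:R :> R by rewrite ler1n.
        by move: (m%:R : R) => mr; lra.
      by rewrite lerDr mulr_ge0 ?divr_ge0// ltW.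
    rewrite -addrA lerD2l /e.
    have -> : r / (4 * m%:R) = r * ((1/4) / m%:R) by field; rewrite gt_eqF.
    rewrite -mulrDr -[leRHS]mulr1 ler_pM2l// -mulrDl ler_pdivrMr// mul1r.
    by have := ltn_ord (k j); rewrite -(ler_nat R) -[(k j).+1]addn1 natrD; lra.
  move=> p pM; apply: contrapT => noj; apply: nok; exists p; split=> // j.
  by rewrite leNgt; apply/negP => ?; apply: noj; exists j.
have {hit} [p pP] := choice hit.
have [N NE] : exists N, N.+1 = (D * m)%N.
  by exists (D * m).-1; rewrite prednK// muln_gt0 D0.
have cell (k : {ffun 'I_n -> 'I_m}) : exists g : {ffun I -> 'I_N.+2}, forall i,
   `|coord (p k) i - ((g i)%:R * (2 * M / N.+1%:R) - M)| <= 2 * M / N.+1%:R.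
  have /choice[g gP] : forall i, exists g : 'I_N.+2,
     `|coord (p k) i - (g%:R * (2 * M / N.+1%:R) - M)| <= 2 * M / N.+1%:R.
    by move=> i; apply: grid_cell => //; apply: (pP k).1.
  by exists [ffun i => g i] => i; rewrite ffunE.
have {cell} [g gP] := choice cell.
have ginj : injective g.
  move=> k1 k2 g12; apply/ffunP => j; apply/val_inj => /=; apply/eqP.
  rewrite eqn_leq.
  have coord12 i : `|coord (p k1) i - coord (p k2) i| <= 4 * M / (D * m)%:R.
    have := gP k1 i; have := gP k2 i; rewrite g12.
    set u := _ * (2 * M / _) - M; rewrite NE.
    have -> : 4 * M / (D * m)%:R = 2 * (2 * M / (D * m)%:R) :> R.
      by rewrite natrM; field; rewrite DR0 mR1.
    by rewrite !ler_norml => /andP[? ?] /andP[? ?]; apply/andP; split; lra.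
  have d0 : 0 <= 4 * M / (D * m)%:R by rewrite divr_ge0 ?ler0n// mulr_ge0// ltW.
  have F12 := KP _ _ _ d0 (pP k1).1 (pP k2).1 coord12 j.
  have sml : K1 * (4 * M / (D * m)%:R) < r / (2 * m%:R).
    have -> : K1 * (4 * M / (D * m)%:R) =
        K1 * (4 * M) * 2 / r * (r / (2 * m%:R)) / D%:R.
      by rewrite natrM; field; rewrite DR0 mR1 gt_eqF.
    by rewrite ltr_pdivrMr ?ltr0n// mulrC ltr_pM2l// divr_gt0 ?mulr_gt0.
  have a12 : `|a k1 j - a k2 j| < r / m%:R.
    have := (pP k1).2 j; have := (pP k2).2 j; move: F12 sml; rewrite /e.
    have -> : r / (4 * m%:R) = (r / m%:R) / 4 by field; rewrite gt_eqF.
    have -> : r / (2 * m%:R) = (r / m%:R) / 2 by field; rewrite gt_eqF.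
    rewrite !ler_norml ltr_norml => /andP[? ?] ? /andP[? ?] /andP[? ?].
    by apply/andP; split; lra.
  have : `|(k1 j)%:R - (k2 j)%:R| < 1 :> R.
    rewrite -(ltr_pM2l (divr_gt0 r0 mR0)) mulr1; apply: le_lt_trans a12.
    rewrite -{1}(gtr0_norm (divr_gt0 r0 mR0)) -normrM /a.
    rewrite le_eqVlt; apply/orP; left; apply/eqP; congr `|_|.
    by field; rewrite gt_eqF.
  rewrite ltr_norml => /andP[h1 h2].
  by apply/andP; split; rewrite -ltnS -(ltr_nat R) -addn1 natrD; lra.
have := leq_card _ ginj; rewrite !card_ffun !card_ord.
apply/negP; rewrite -ltnNge.
(* (Dm + 1)^|I| <= (2D)^|I| m^|I| < m^(|I|+1) <= m^n. *)
apply: (@leq_ltn_trans ((D.*2 * m) ^ #|I|)).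
  rewrite NE; case: #|I| => // i.
  by rewrite leq_exp2r// -addnn mulnDl -addn1 leq_add2l muln_gt0 D0.
rewrite expnMn; apply: (@leq_trans (m ^ #|I|.+1)); last by rewrite leq_pexp2l.
by rewrite expnS ltn_pmul2r ?expn_gt0 ?m0// mE.
Qed.

(** A Baire-style argument: nested boxes, the k-th missing the image of the cube of half-side k,
    have a common point. Every [p] lies in one of these cubes, so that point is not its image. *)
Lemma lipschitz_not_surjective : lipschitz_on_boxes -> (#|I| < n)%N ->
  exists y : 'I_n -> R, forall p, exists j, F p j != y j.
Proof.
move=> lipF In.
have /choice[next nextP] : forall kB : nat * (('I_n -> R) * R),
    exists B', 0 < kB.2.2 -> [/\ 0 < B'.2,
      forall j, kB.2.1 j - kB.2.2 <= B'.1 j - B'.2 /\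
                B'.1 j + B'.2 <= kB.2.1 j + kB.2.2
      & misses_box kB.1.+1%:R B'].
  move=> [k B] /=; case: (ltrP 0 B.2) => [B0|_]; last by exists B.
  have [B' B'P] := misses_subbox lipF In (ltr0Sn R k) B0.
  by exists B'.
pose B := nat_rect (fun=> (('I_n -> R) * R)%type) (fun=> 0, 1)
  (fun k b => next (k, b)).
have B0 k : 0 < (B k).2.
  by elim: k => [|k IH]; [exact: ltr01 | case: (nextP (k, B k) IH)].
have BS k : misses_box k.+1%:R (B k.+1) by case: (nextP (k, B k) (B0 k)).
have Bnest k d j : (B k).1 j - (B k).2 <= (B (d + k)%N).1 j - (B (d + k)%N).2 /\
    (B (d + k)%N).1 j + (B (d + k)%N).2 <= (B k).1 j + (B k).2.
  elim: d => [|d [IH1 IH2]]; first by rewrite add0n.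
  case: (nextP ((d + k)%N, B (d + k)%N) (B0 _)) => _ /(_ j)[s1 s2] _.
  by split; [exact: le_trans s1 | exact: le_trans IH2].
have Blow k l j : (B k).1 j - (B k).2 <= (B l).1 j + (B l).2.
  have mid i : (B i).1 j - (B i).2 <= (B i).1 j + (B i).2.
    by move: (B0 i); lra.
  case: (leqP k l) => [/subnK <-|/ltnW /subnK <-].
    by case: (Bnest k (l - k)%N j) => h _; apply: le_trans h (mid _).
  by case: (Bnest l (k - l)%N j) => _; apply: le_trans (mid _).
(* The common point has as coordinates the suprema of the lower ends; by [Blow] they stay below all
   upper ends. *)
pose low j : set R := fun z => exists k, z = (B k).1 j - (B k).2.
exists (fun j => sup (low j)) => p.
pose k := Num.truncn (\sum_i `|coord p i|).
have [|j Hj] := BS k p.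
  move=> i; apply: le_trans (ltW (truncnS_gt _)).
  by rewrite (bigD1 i)//= lerDl sumr_ge0.
exists j; apply/eqP => Fpj; move: Hj; rewrite Fpj; apply/negP; rewrite -leNgt.
have lowub l : ubound (low j) ((B l).1 j + (B l).2).
  by move=> _ [i ->]; apply: Blow.
have up : sup (low j) <= (B k.+1).1 j + (B k.+1).2.
  by apply: ge_sup => //; exists ((B 0).1 j - (B 0).2); exists 0.
have dn : (B k.+1).1 j - (B k.+1).2 <= sup (low j).
  apply: ub_le_sup; last by exists k.+1.
  by exists ((B 0).1 j + (B 0).2).
by rewrite ler_norml; apply/andP; split; lra.
Qed.
End NoSurjection.

(** * Uniform Lipschitz bounds on compact intervals *)

Section Lipschitz.
Variable R : realType.
Implicit Types (rho : R -> R).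
Local Open Scope classical_set_scope.

Lemma locally_lipschitz_continuous rho : locally_lipschitz rho -> continuous rho.
Proof.
move=> lip x; have [r [C [r0 rC]]] := lip x.
apply/(@cvgrPdist_lt _ R^o) => e e0; near=> y.
have xy : `|x - y| < r by near: y; apply: cvgr_dist_lt.
have xx : `|x - x| < r by rewrite subrr normr0.
have h : `|x - y| < e / (`|C| + 1).
  by near: y; apply: cvgr_dist_lt => //; rewrite divr_gt0// ltr_wpDl.
rewrite distrC in xy; apply: le_lt_trans (rC _ _ xx xy) _.
apply: (@le_lt_trans _ _ ((`|C| + 1) * `|x - y|)).
  by apply: ler_wpM2r => //; move: (ler_norm C); lra.
by rewrite mulrC -ltr_pdivlMr// ltr_wpDl.
Unshelve. all: by end_near. Qed.

Lemma locally_lipschitz_bounded rho (M : R) : locally_lipschitz rho ->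
  exists K : R, [/\ 0 <= K, forall y, `|y| <= M -> `|rho y| <= K &
    forall y z, `|y| <= M -> `|z| <= M -> `|rho y - rho z| <= K * `|y - z|].
Proof.
move=> lip.
(* [C] is at once the bound, the Lipschitz constant and the inverse radius, so a single limit at +oo
   makes all three uniform by compactness. *)
pose P (C x : R) := `|rho x| <= C /\ forall y z,
  `|y - x| < C^-1 -> `|z - x| < C^-1 -> `|rho y - rho z| <= C * `|y - z|.
have : \forall C \near +oo, `[- M, M] `<=` P C.
  have /compact_near_coveringP/(_ R (pinfty_nbhs R) P) := @segment_compact R (- M) M.
  apply=> x _; have [r [C [r0 rC]]] := lip x.
  near=> x' C'; rewrite /P.
  have x'x : `|x - x'| < r / 2.
    by near: x'; apply: cvgr_dist_lt => //; rewrite divr_gt0.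
  have CC' : `|C| < C' by near: C'; apply: nbhs_pinfty_gt; rewrite num_real.
  have C'0 : 0 < C' by apply: le_lt_trans CC'.
  have rC' : (r / 2)^-1 < C' by near: C'; apply: nbhs_pinfty_gt; rewrite num_real.
  have C'r : C'^-1 < r / 2 by rewrite invf_plt ?posrE// divr_gt0.
  have B : `|rho x| + `|C| * r < C'.
    by near: C'; apply: nbhs_pinfty_gt; rewrite num_real.
  split => /=.
    have := rC x' x; rewrite (distrC x' x) subrr normr0.
    have x'r : `|x - x'| < r by lra.
    move=> /(_ x'r r0) h.
    have : `|rho x' - rho x| <= `|C| * r.
      apply: le_trans h _; apply: le_trans (ler_wpM2r _ (ler_norm C)) _ => //.
      by apply: ler_wpM2l => //; apply: ltW.
    have := ler_normD (rho x' - rho x) (rho x); rewrite subrK; lra.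
  move=> y z yx' zx'.
  have near_x w : `|w - x'| < C'^-1 -> `|w - x| < r.
    by move=> ?; have := ler_distD x' w x; rewrite (distrC x' x); lra.
  apply: le_trans (rC y z (near_x _ yx') (near_x _ zx')) _.
  by apply: ler_wpM2r => //; move: (ler_norm C); lra.
move=> nearP.
have [C [C1 CP]] : exists C, 1 < C /\ `[- M, M] `<=` P C.
  near (pinfty_nbhs R) => C; exists C; split.
    by near: C; apply: nbhs_pinfty_gt; rewrite num_real.
  by near: C.
have C0 : 0 < C by lra.
have inM y : `|y| <= M -> `[- M, M] y by rewrite /= in_itv /= ler_norml.
have C2 : C <= 2 * C ^+ 2.
  by rewrite expr2 mulrA ler_peMl ?(ltW C0)//; lra.
exists (2 * C ^+ 2); split; first by lra.
  by move=> y /inM /CP[yC _]; lra.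
move=> y z yM zM; have [yC lipC] := CP _ (inM _ yM); have [zC _] := CP _ (inM _ zM).
(* Close pairs obey the local estimate. For the others the difference is at most 2C, while 1 <= C|y
   - z|. *)
case: (ltrP `|z - y| C^-1) => zy.
  have := lipC y z; rewrite subrr normr0 invr_gt0 C0 => /(_ isT zy) h.
  by apply: le_trans h _; apply: ler_wpM2r.
have : 1 <= C * `|y - z| by rewrite distrC mulrC -ler_pdivrMr// mul1r.
move=> h; have : C * 1 <= C * (C * `|y - z|) by rewrite ler_pM2l.
have := ler_normB (rho y) (rho z).
rewrite mulr1 mulrA -expr2 -mulrA; lra.
Unshelve. all: by end_near. Qed.

End Lipschitz.

(** * Lipschitz dependence of realizations on the parameters *)

Section NetworkCoordinates.
Variables (R : realType) (N : nat -> nat).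
Implicit Types (rho : R -> R) (Phi Psi : network R N).

(** Its cardinality, the sum of N_{l+1} (N_l + 1) over l < L, is the number of weights and
    biases. *)
Definition parameter (L : nat) : finType :=
  {l : 'I_L & ('I_(N l.+1) * 'I_(N l) + 'I_(N l.+1))%type}.

Definition coord L Phi (q : parameter L) : R :=
  match tagged q with
  | inl ij => (Phi (tag q)).1 ij.1 ij.2
  | inr i => (Phi (tag q)).2 i 0
  end.

(** Rests on A h - A' h' = (A - A') h + A' (h - h'). *)
Lemma affine_lipschitz m n (A A' : 'M[R]_(m, n)) (b b' : 'cV[R]_m)
    (h h' : 'cV[R]_n) (M B K d : R) :
  0 <= M -> 0 <= B -> 0 <= d ->
  (forall i j, `|A i j| <= M) -> (forall i, `|b i 0| <= M) ->
  (forall i j, `|A' i j| <= M) ->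
  (forall i j, `|A i j - A' i j| <= d) -> (forall i, `|b i 0 - b' i 0| <= d) ->
  (forall j, `|h j 0| <= B) -> (forall j, `|h j 0 - h' j 0| <= K * d) ->
  forall i, `|(A *m h + b) i 0| <= n%:R * (M * B) + M /\
    `|(A *m h + b) i 0 - (A' *m h' + b') i 0| <= (n%:R * (B + M * K) + 1) * d.
Proof.
move=> M0 B0 d0 AM bM A'M AA' bb' hB hh' i; rewrite !mxE; split.
  apply: le_trans (ler_normD _ _) _; apply: lerD => //.
  apply: le_trans (ler_norm_sum _ _ _) _.
  rewrite -[X in X%:R]card_ord -sum1_card natr_sum mulr_suml.
  by apply: ler_sum => j _; rewrite mul1r normrM ler_pM.
rewrite opprD addrACA -sumrB mulrDl mul1r.
apply: le_trans (ler_normD _ _) _; apply: lerD => //.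
apply: le_trans (ler_norm_sum _ _ _) _.
rewrite -[X in X%:R]card_ord -sum1_card natr_sum -mulrA mulr_suml.
apply: ler_sum => j _; rewrite mul1r.
have -> : A i j * h j 0 - A' i j * h' j 0 =
  (A i j - A' i j) * h j 0 + A' i j * (h j 0 - h' j 0) by ring.
apply: le_trans (ler_normD _ _) _; rewrite [leRHS]mulrDl; apply: lerD.
  by rewrite normrM mulrC ler_pM.
by rewrite normrM -mulrA ler_pM.
Qed.

(** The bound [B] is carried along because the estimate for the next layer multiplies weights by
    these values. *)
Definition parameter_lipschitz L (M : R) m (f : network R N -> 'cV[R]_m) :=
  exists B K : R, 0 <= B /\ forall Phi Psi d, 0 <= d ->
    (forall q, `|@coord L Phi q| <= M) -> (forall q, `|@coord L Psi q| <= M) ->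
    (forall q, `|@coord L Phi q - coord Psi q| <= d) ->
    forall i, `|f Phi i 0| <= B /\ `|f Phi i 0 - f Psi i 0| <= K * d.

Lemma layer_lipschitz L (M : R) k (f : network R N -> 'cV[R]_(N k)) :
  0 <= M -> (k < L)%N -> parameter_lipschitz L M f ->
  parameter_lipschitz L M (fun Phi => (Phi k).1 *m f Phi + (Phi k).2).
Proof.
move=> M0 kL [B [K [B0 BK]]].
exists ((N k)%:R * (M * B) + M), ((N k)%:R * (B + M * K) + 1).
split=> [|Phi Psi d d0 PhiM PsiM close]; first by rewrite addr_ge0 ?mulr_ge0.
pose l := Ordinal kL.
pose T (l : 'I_L) : Type := ('I_(N l.+1) * 'I_(N l) + 'I_(N l.+1))%type.
have weight (Phi' : network R N) i' j' :
  (Phi' k).1 i' j' = coord Phi' (Tagged T (inl (i', j') : T l)) by [].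
have bias (Phi' : network R N) i' :
  (Phi' k).2 i' 0 = coord Phi' (Tagged T (inr i' : T l)) by [].
by apply: affine_lipschitz => // [i j|i|i j|i j|i|j|j]; rewrite ?weight ?bias //;
  case: (BK _ _ _ d0 PhiM PsiM close j).
Qed.

Lemma hidden_lipschitz rho (x : 'cV[R]_(N 0%N)) (M : R) L k :
  locally_lipschitz rho -> 0 <= M -> (k <= L)%N ->
  parameter_lipschitz L M (fun Phi => hidden rho Phi x k).
Proof.
move=> lip M0; elim: k => [_|k IH kL].
  exists (\sum_i `|x i 0|), 0; split; first by rewrite sumr_ge0.
  move=> Phi Psi d _ _ _ _ i /=; rewrite subrr normr0 mul0r; split=> //.
  by rewrite (bigD1 i)//= lerDl sumr_ge0.
have [B [K [B0 BK]]] := layer_lipschitz M0 kL (IH (ltnW kL)).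
have [C [C0 Cbd Clip]] := locally_lipschitz_bounded B lip.
exists C, (C * K); split=> // Phi Psi d d0 PhiM PsiM close i.
have [aff1 aff2] := BK _ _ _ d0 PhiM PsiM close i.
(* Comparing [Psi] with itself at distance 0 bounds its preactivation too, so that the Lipschitz
   estimate of [rho] applies to both. *)
have zero q : `|@coord L Psi q - coord Psi q| <= 0 by rewrite subrr normr0.
have [aff3 _] := BK _ _ _ (lexx 0) PsiM PsiM zero i.
rewrite /= ![map_mx _ _ _ _]mxE; split; first exact: Cbd.
by apply: le_trans (Clip _ _ aff1 aff3) _; rewrite -mulrA ler_wpM2l.
Qed.

Lemma realization_lipschitz rho (x : 'cV[R]_(N 0%N)) (M : R) L :
  locally_lipschitz rho -> 0 <= M ->
  parameter_lipschitz L M (fun Phi => realization L rho Phi x).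
Proof.
case: L => [|L] lip M0; first exact: (@hidden_lipschitz rho x M 0 0).
exact/layer_lipschitz/hidden_lipschitz.
Qed.

End NetworkCoordinates.

(** * Linearity and dimension of the set of realizations *)

Section LinearRealizations.
Variables (R : realType) (N : nat -> nat) (L : nat) (rho : R -> R).
Variable Omega : 'cV[R]_(N 0%N) -> Prop.
Local Notation realizable := (@in_RNN R N L.+1 rho Omega).

Lemma hidden_prefix (Phi Psi : network R N) x k :
  (forall l, (l < k)%N -> Phi l = Psi l) ->
  hidden rho Phi x k = hidden rho Psi x k.
Proof.
elim: k => //= k IH PhiPsi; rewrite PhiPsi// IH// => l lk.
by apply: PhiPsi; apply: ltnW.
Qed.

(** No activation follows the last layer, so it suffices to scale its weights and biases. *)
Lemma in_RNN_scale c g : realizable g -> realizable (fun x => c *: g x).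
Proof.
move=> [Phi gPhi]; pose t l : R := if l == L then c else 1.
exists (fun l => (t l *: (Phi l).1, t l *: (Phi l).2)) => x Ox.
rewrite gPhi//= /t eqxx scalerDr -scalemxAl; congr (_ + _); congr (_ *: (_ *m _)).
apply: hidden_prefix => l lL; rewrite (ltn_eqF lL) !scale1r.
by case: (Phi l).
Qed.

Hypothesis convex : RNN_convex L.+1 rho Omega.

(** The sum is the midpoint of 2 g1 and 2 g2. *)
Lemma in_RNN_add g1 g2 :
  realizable g1 -> realizable g2 -> realizable (fun x => g1 x + g2 x).
Proof.
move=> g1R g2R.
have [|Phi PhiP] := convex (t := 2^-1) (in_RNN_scale 2 g1R) (in_RNN_scale 2 g2R).
  by apply/andP; split; lra.
exists Phi => x Ox; rewrite -PhiP//= !scalerA.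
have -> : (1 - 2^-1) * 2 = 1 :> R by field.
have -> : 2^-1 * 2 = 1 :> R by field.
by rewrite !scale1r.
Qed.

Lemma in_RNN_lincomb n (c : 'I_n -> R) (g : 'I_n -> 'cV_(N 0%N) -> 'cV_(N L.+1)) :
  (forall i, realizable (g i)) -> realizable (fun x => \sum_i c i *: g i x).
Proof.
move=> gR; elim: {c g gR}n c g gR => [|n IH] c g gR.
  exists (fun l => (0, 0)) => x _; rewrite big_ord0 /=.
  by rewrite mul0mx addr0.
have [Phi PhiP] := in_RNN_add (in_RNN_scale (c ord0) (gR ord0))
  (IH (c \o lift ord0) _ (fun i => gR (lift ord0 i))).
by exists Phi => x Ox; rewrite -PhiP// big_ord_recl.
Qed.

(* Otherwise a linear combination realizes any prescribed values at the points
   [x j], and the parameters map locally Lipschitz onto a space of larger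
   dimension. *)
Lemma realization_det0 n (Phi : 'I_n -> network R N) (x : 'I_n -> 'cV_(N 0%N))
    (o : 'I_(N L.+1)) :
  locally_lipschitz rho -> (#|parameter N L.+1| < n)%N ->
  (forall j, Omega (x j)) ->
  \det (\matrix_(i, j) realization L.+1 rho (Phi i) (x j) o 0) = 0.
Proof.
move=> lip In Ox; set A := \matrix_(i, j) _.
have [//|detA] := eqVneq (\det A) 0.
have Aunit : A \in unitmx by rewrite unitmxE unitfE.
pose F (Psi : network R N) (j : 'I_n) := realization L.+1 rho Psi (x j) o 0.
have Flip : lipschitz_on_boxes (@coord R N L.+1) F.
  move=> M M0.
  have /choice[K KP] : forall j, exists K : R, forall Psi Psi' d, 0 <= d ->
      (forall q, `|@coord R N L.+1 Psi q| <= M) ->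
      (forall q, `|@coord R N L.+1 Psi' q| <= M) ->
      (forall q, `|@coord R N L.+1 Psi q - coord Psi' q| <= d) ->
      `|F Psi j - F Psi' j| <= K * d.
    move=> j; have [B [K [_ BK]]] := realization_lipschitz (x j) L.+1 lip M0.
    by exists K => Psi Psi' d d0 PM P'M PP'; case: (BK _ _ _ d0 PM P'M PP' o).
  exists (\sum_j `|K j|) => p q d d0 pM qM pq j.
  apply: le_trans (KP j _ _ _ d0 pM qM pq) _; apply: ler_wpM2r => //.
  by apply: le_trans (ler_norm _) _; rewrite (bigD1 j)//= lerDl sumr_ge0.
have [y yP] := lipschitz_not_surjective Flip In.
(* With c A = y, the combination of the realizations with coefficients [c] takes the missed values
   [y]. *)
pose c := (\row_j y j) *m invmx A.
have [|Psi PsiP] := in_RNN_lincomb (c 0)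
  (g := fun i x => realization L.+1 rho (Phi i) x).
  by move=> i; exists (Phi i).
have [j /negP[]] := yP Psi; apply/eqP.
rewrite /F -(PsiP _ (Ox j)) summxE.
transitivity ((c *m A) 0 j); last by rewrite mulmxKV// mxE.
by rewrite mxE; apply: eq_bigr => i _; rewrite !mxE.
Qed.

End LinearRealizations.

(** * Networks with one active neuron per layer *)

Section Chains.
Variables (R : realType) (rho : R -> R).
Implicit Types (s : seq (R * R)) (N : nat -> nat).

(** The hidden layers of a width-one network; the head of [s] holds the weight and bias of the
    innermost layer. *)
Definition chain s (y : R) : R := foldl (fun z ab => rho (ab.1 * z + ab.2)) y s.

(* Only neuron 0 of each layer is read by the next one. *)
Definition chain_network N s : network R N := fun l =>
  (\matrix_(i, j) if val j == 0%N then (nth (1, 0) s l).1 else 0,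
   const_mx (nth (1, 0) s l).2).

Lemma chain_affine N s l (h : 'cV_(N l)) (o : 'I_(N l)) i : val o = 0%N ->
  ((chain_network N s l).1 *m h + (chain_network N s l).2) i 0
  = (nth (1, 0) s l).1 * h o 0 + (nth (1, 0) s l).2.
Proof.
move=> o0; rewrite !mxE (bigD1 o)//= !mxE o0 eqxx big1 ?addr0// => j jo.
by rewrite mxE; case: eqP => [j0|_]; [rewrite -val_eqE /= j0 o0 in jo | rewrite mul0r].
Qed.

Lemma hidden_chain N s (x : 'cV_(N 0%N)) (o : 'I_(N 0%N)) k (i : 'I_(N k)) :
  (forall l, (l <= k)%N -> (0 < N l)%N) -> (k <= size s)%N ->
  val o = 0%N -> val i = 0%N ->
  hidden rho (chain_network N s) x k i 0 = chain (take k s) (x o 0).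
Proof.
move=> Npos ks o0; elim: k i Npos ks => [|k IH] i Npos ks i0.
  by rewrite take0 /=; congr (x _ _); apply: val_inj; rewrite i0 o0.
rewrite [LHS]/= mxE (@chain_affine N s k _ (Ordinal (Npos k (leqnSn k))))//.
rewrite IH//; last 2 first.
- by move=> l lk; apply: Npos; apply: leqW.
- exact: ltnW.
by rewrite (take_nth (1, 0))// /chain foldl_rcons.
Qed.

Lemma realization_chain N L s (x : 'cV_(N 0%N)) (o : 'I_(N 0%N)) (i : 'I_(N L.+1)) :
  (forall l, (l <= L)%N -> (0 < N l)%N) -> size s = L -> val o = 0%N ->
  realization L.+1 rho (chain_network N s) x i 0 = chain s (x o 0).
Proof.
move=> Npos sL o0; rewrite [LHS]/=.
rewrite (@chain_affine N s L _ (Ordinal (Npos L (leqnn L))))//.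
(* Past the end of [s] the default pair (1, 0) makes the output layer copy neuron 0. *)
rewrite (@hidden_chain N s x o)// ?sL// nth_default ?sL//=.
by rewrite mul1r addr0 -sL take_size.
Qed.

(** Each new layer maps the two distinct values reached so far affinely to [y] and [z], which [rho]
    separates. *)
Lemma chain_nonconstant (u v y z : R) k : u != v -> rho y != rho z ->
  exists2 s, size s = k & chain s u != chain s v.
Proof.
move=> uv yz; elim: k => [|k [s sk suv]]; first by exists [::].
pose a := (y - z) / (chain s u - chain s v).
exists (rcons s (a, y - a * chain s u)); first by rewrite size_rcons sk.
rewrite /chain !foldl_rcons /= -!/(chain _ _).
have -> : a * chain s u + (y - a * chain s u) = y by ring.
suff -> : a * chain s v + (y - a * chain s u) = z by [].
by rewrite /a; field; rewrite subr_eq0.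
Qed.

Local Open Scope classical_set_scope.

Lemma chain_continuous s : continuous rho -> continuous (chain s).
Proof.
move=> rhoC; elim/last_ind: s => [|s [a b] IH] y; first exact: cvg_id.
have -> : chain (rcons s (a, b)) = rho \o (fun z => a * chain s z + b).
  by apply/funext => z; rewrite /chain foldl_rcons.
apply: continuous_comp; last exact: rhoC.
by apply: cvgD; [apply: cvgM; [exact: cvg_cst|exact: IH] | exact: cvg_cst].
Qed.

Lemma continuous_onto_segment (f : R -> R) (u v : R) : continuous f -> u <= v ->
  forall y, Num.min (f u) (f v) <= y <= Num.max (f u) (f v) ->
  exists2 z, u <= z <= v & f z = y.
Proof.
move=> fC uv y yuv; have [//|z] := IVT uv _ yuv; first exact: continuous_subspaceT.
by rewrite in_itv => ? ?; exists z.
Qed.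

End Chains.

(** * From realizations on Omega to affine substitutions on the line *)

Section AffineFamily.
Variables (R : realType) (N : nat -> nat) (L : nat) (rho : R -> R).
Variable Omega : 'cV[R]_(N 0%N) -> Prop.
Hypothesis Npos : forall l, (l <= L.+2)%N -> (0 < N l)%N.
Hypothesis interior : nonempty_interior Omega.
Hypothesis lip : locally_lipschitz rho.
Hypothesis convex : RNN_convex L.+2 rho Omega.

(** Along a segment in Omega a nonconstant chain [s] takes all values of some [p, q]. The [y j],
    rescaled into [p, q], are thus reached at points of Omega, and one more hidden layer undoes the
    rescaling and applies [ab i]; [realization_det0] then applies. *)
Lemma affine_family_det0 n (ab : 'I_n -> R * R) (y : 'I_n -> R) :
  (exists u v, rho u != rho v) -> (#|parameter N L.+2| < n)%N ->
  \det (\matrix_(i, j) rho ((ab i).1 * y j + (ab i).2)) = 0.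
Proof.
move=> [u [v uv]] In; have [x0 [r [r0 Omega0]]] := interior.
pose o : 'I_(N 0%N) := Ordinal (Npos (leq0n _)).
pose c := x0 o 0.
have cr : c != c + r / 2 by rewrite lt_eqF// ltrDl divr_gt0.
have [s sL sc] := chain_nonconstant L cr uv.
set p := Num.min (chain rho s c) (chain rho s (c + r / 2)).
set q := Num.max (chain rho s c) (chain rho s (c + r / 2)).
have pq : p < q.
  by rewrite /p /q; case: (ltgtP (chain rho s c)) sc.
pose T := \sum_j `|y j|.
have yT j : `|y j| <= T by rewrite /T (bigD1 j)//= lerDl sumr_ge0.
have T0 : 0 <= T by rewrite sumr_ge0.
(* The [+ 1] keeps [h] defined when all [y j] vanish; h T <= (q - p)/2 keeps every [w j] in
   [p, q]. *)
pose h := (q - p) / (2 * (T + 1)).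
have h0 : 0 < h by rewrite divr_gt0; lra.
pose w j := (p + q) / 2 + h * y j.
have hT : h * T <= (q - p) / 2.
  have -> : h * T = (q - p) / 2 * (T / (T + 1)) by rewrite /h; field; lra.
  by rewrite ler_piMr ?divr_ge0 ?ler_pdivrMr; lra.
have /choice[z zP] : forall j, exists z, `|z - c| < r /\ chain rho s z = w j.
  move=> j.
  have [z zc <-] : exists2 z, c <= z <= c + r / 2 & chain rho s z = w j.
    apply: continuous_onto_segment.
    - exact/chain_continuous/locally_lipschitz_continuous.
    - by lra.
    - rewrite -/p -/q /w.
      have : `|h * y j| <= h * T by rewrite normrM (gtr0_norm h0) ler_wpM2l// ltW.
      by rewrite ler_norml => /andP[? ?]; apply/andP; split; lra.
  by exists z; split=> //; rewrite ltr_norml; apply/andP; split; lra.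
pose x j : 'cV_(N 0%N) := \col_i if i == o then z j else x0 i 0.
pose t i : seq (R * R) :=
  rcons s ((ab i).1 / h, (ab i).2 - (ab i).1 / h * ((p + q) / 2)).
have Ox j : Omega (x j).
  apply: Omega0 => i; rewrite !mxE; case: eqP => [->|_]; first exact: (zP j).1.
  by rewrite subrr normr0.
have := realization_det0 convex (fun i => chain_network N (t i))
  (Ordinal (Npos (leqnn _))) lip In Ox.
move=> <-; congr (\det _); apply/matrixP => i j; rewrite [LHS]mxE [RHS]mxE.
rewrite (@realization_chain _ _ N L.+1 _ _ o)//; last 2 first.
- by move=> l lL; apply: Npos; apply: leqW.
- by rewrite size_rcons sL.
rewrite mxE eqxx /chain foldl_rcons -/(chain _ _ _) (zP j).2 /w /=.
by congr rho; field; lra.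
Qed.

End AffineFamily.

(** * Lagrange bases of finite-dimensional function spaces *)

Section Skeleton.
Variables (K : fieldType) (I X : Type) (G : I -> X -> K).

(* A nonsingular sample [G (i k) (x l)] of maximal size yields a Lagrange basis
   [F] of the span of the functions [G i]: a vanishing bordered determinant
   expresses the bordering function through the sample. *)
Lemma lagrange_basis n :
  (forall (i : 'I_n -> I) (x : 'I_n -> X),
     \det (\matrix_(k, l) G (i k) (x l)) = 0) ->
  exists m (x : 'I_m -> X) (F : 'I_m -> X -> K),
    [/\ exists (i : 'I_m -> I) (C : 'M[K]_m),
          forall l y, F l y = \sum_k C l k * G (i k) y,
        forall l k, F l (x k) = (l == k)%:R
      & forall i' y, G i' y = \sum_l G i' (x l) * F l y].
Proof.
elim: n => [|n IH] det0.
  (* The empty determinant is 1, so the hypothesis fails for n = 0. *)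
  have absurd (T : Type) : 'I_0 -> T by case.
  by move: (det0 (absurd I) (absurd X)); rewrite det_mx00 => /eqP; rewrite oner_eq0.
case: (pselect (exists (i : 'I_n -> I) (x : 'I_n -> X),
    \det (\matrix_(k, l) G (i k) (x l)) != 0)) => [[i [x]]|ns]; last first.
  by apply: IH => i x; apply: contrapT => /eqP ?; apply: ns; exists i, x.
set A := \matrix_(k, l) _ => detA.
have Aunit : A \in unitmx by rewrite unitmxE unitfE.
exists n, x, (fun l y => \sum_k invmx A l k * G (i k) y); split.
- by exists i, (invmx A).
-  move=> l k; transitivity ((invmx A *m A) l k); last by rewrite mulVmx// mxE.
  by rewrite mxE; apply: eq_bigr => j _; rewrite mxE.
- move=> i' y.
(* Index 0 of the bordered sample is the new function [i'] and the new point [y]. *)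
pose ii k := if unlift ord0 k is Some k' then i k' else i'.
pose xx l := if unlift ord0 l is Some l' then x l' else y.
have /eqP/det0P[v v0 vB] := det0 ii xx.
pose w : 'rV_n := \row_k v 0 (lift ord0 k).
have eqv l : v 0 ord0 * G i' (xx l) + \sum_k w 0 k * G (i k) (xx l) = 0.
  move/matrixP: vB => /(_ 0 l); rewrite mxE big_ord_recl [RHS]mxE => vb.
  rewrite -[RHS]vb mxE /ii unlift_none.
  by congr (_ + _); apply: eq_bigr => k _; rewrite !mxE liftK.
have wA l : (w *m A) 0 l = - (v 0 ord0 * G i' (x l)).
  apply/eqP; rewrite -addr_eq0 addrC; apply/eqP.
  have := eqv (lift ord0 l); rewrite /xx liftK => el; rewrite -[RHS]el.
  by rewrite mxE; congr (_ + _); apply: eq_bigr => k _; rewrite [A _ _]mxE.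
(* A relation without [i'] would put a nonzero vector in the left kernel of the invertible [A]. *)
have v00 : v 0 ord0 != 0.
  apply: contra v0 => /eqP v00.
  have w0 : w = 0.
    rewrite -[w](mulmxK Aunit); suff -> : w *m A = 0 by rewrite mul0mx.
    by apply/rowP => l; rewrite wA v00 mul0r oppr0 mxE.
  apply/eqP/rowP => k; rewrite [RHS]mxE; case: (unliftP ord0 k) => [j|] ->//.
  by move/rowP: w0 => /(_ j); rewrite !mxE.
pose r := \row_l G i' (x l).
have wE : w = - v 0 ord0 *: (r *m invmx A).
  rewrite -[w](mulmxK Aunit) scalemxAl; congr (_ *m _).
  by apply/rowP => l; rewrite wA !mxE mulNr.
move: (eqv ord0); rewrite /xx unlift_none => /eqP.
rewrite addr_eq0 -sumrN => /eqP h.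
apply: (mulfI v00); rewrite h.
transitivity (v 0 ord0 * \sum_k (r *m invmx A) 0 k * G (i k) y).
  rewrite mulr_sumr; apply: eq_bigr => k _; rewrite wE.
  by move: (r *m _) => u; rewrite mxE; ring.
congr (_ * _).
under [RHS]eq_bigr do rewrite mulr_sumr.
rewrite exchange_big; apply: eq_bigr => k _ /=.
rewrite mxE mulr_suml; apply: eq_bigr => l _; rewrite mxE; ring.
Qed.

End Skeleton.

(** * Functions polynomial along arithmetic progressions *)

Section PolynomialOnProgressions.
Variable R : realType.
Implicit Types (f : R -> R) (p q : {poly R}).

Lemma poly_eq_nat p q : (forall k : nat, p.[k%:R] = q.[k%:R]) -> p = q.
Proof.
move=> pq; apply/eqP; rewrite -subr_eq0; apply: contraT => pq0.
have := @max_poly_roots R _ [seq k%:R | k <- iota 0 (size (p - q))] pq0.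
rewrite size_map size_iota ltnn; apply.
  by apply/allP => _ /mapP[k _ ->]; rewrite /root !hornerE pq subrr.
by rewrite map_inj_uniq ?iota_uniq// => a b /eqP; rewrite eqr_nat => /eqP.
Qed.

Lemma binomial_poly i : exists p, forall k : nat, p.[k%:R] = 'C(k, i)%:R.
Proof.
have [p pP] : exists p, forall k : nat, p.[k%:R] = (k ^_ i)%:R.
  elim: i => [|i [p pP]]; first by exists 1 => k; rewrite hornerE.
  exists (p * ('X - i%:R%:P)) => k; rewrite !hornerE pP ffactnSr natrM.
  (* For k < i truncated subtraction differs from [k - i], but the factor [k ^_ i] is already 0. *)
  have [ik|ki] := leqP i k; first by rewrite natrB.
  by rewrite ffact_small// !mul0r.
exists (i`!%:R^-1 *: p) => k.
rewrite hornerZ pP -bin_ffact natrM mulrC mulfK//.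
by rewrite pnatr_eq0 -lt0n fact_gt0.
Qed.

Local Open Scope classical_set_scope.

(** A progression of step 1/d starting at a suitable negative integer passes through a given
    rational of denominator d and through all naturals, where its polynomial must match [P]. So f =
    P on the rationals, hence everywhere by continuity. *)
Lemma polynomial_of_progressions f : continuous f ->
  (forall z t, exists p, forall k : nat, f (z + k%:R * t) = p.[k%:R]) ->
  is_polynomial f.
Proof.
move=> fC fp; have [P PP] := fp 0 1; exists P.
have frat (r : rat) : f (ratr r) = P.[ratr r].
  have den0 : (denq r)%:~R != 0 :> R by rewrite intr_eq0 denq_neq0.
  pose d := `|denq r|%N; pose K := `|numq r|%N.
  have dE : (denq r)%:~R = d%:R :> R.
    by rewrite /d natr_absz gtr0_norm ?denq_gt0.
  have d0 : d%:R != 0 :> R by rewrite -dE.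
  have [p pP] := fp (- K%:R) d%:R^-1.
  (* Index d (k + K) of the progression is the natural number k. *)
  have eP : p \Po (d%:R *: ('X + K%:R%:P)) = P.
    apply: poly_eq_nat => k; rewrite horner_comp !hornerE -natrD -natrM -pP.
    have := PP k; rewrite add0r mulr1 => <-; congr f.
    by rewrite natrM natrD; field.
  have [j jE] : exists j : nat, (numq r)%:~R = j%:R - K%:R * d%:R :> R.
    have d1 : (0 < d)%N by rewrite absz_gt0 denq_neq0.
    exists (absz (numq r + (K * d)%N%:Z)); rewrite natr_absz ger0_norm.
      by rewrite rmorphD /= -natrM; ring.
    by rewrite /K; move: (numq r) => a; nia.
  have -> : ratr r = - K%:R + j%:R * d%:R^-1 :> R.
    by rewrite /ratr dE jE; field.
  rewrite pP -eP horner_comp !hornerE; congr (_.[_]); field.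
  exact: d0.
move=> x; apply: contrapT => /eqP fPx.
have gC : continuous (fun y => f y - P.[y]).
  by move=> y; apply: cvgB; [exact: fC | exact: continuous_horner].
have e0 : 0 < `|f x - P.[x]| by rewrite normr_gt0 subr_eq0.
have /(@cvgrPdist_lt _ R^o)/(_ _ e0) [e /= e1 eP] := gC x.
have /rat_in_itvoo[r] : x < x + e by rewrite ltrDl.
rewrite in_itv /= => /andP[xr re].
have xre : `|x - ratr r| < e by rewrite ltr_norml; apply/andP; split; lra.
by have := eP (ratr r) xre; rewrite /= frat subrr subr0 ltxx.
Qed.

End PolynomialOnProgressions.

(** * Unipotence of translations on an affine-invariant space *)

Section AffineInvariantSpace.
Variables (R : realType) (rho : R -> R) (n : nat).
Hypothesis rhoC : continuous rho.
Hypothesis rho_det0 : forall (ab : 'I_n -> R * R) (y : 'I_n -> R),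
  \det (\matrix_(i, j) rho ((ab i).1 * y j + (ab i).2)) = 0.

Local Open Scope classical_set_scope.

Lemma det_continuous m (A : R -> 'M[R]_m) :
  (forall i j, continuous (fun t => A t i j)) -> continuous (fun t => \det (A t)).
Proof.
move=> AC; rewrite /determinant.
apply: continuous_big => [|s _]; first exact: add_continuous.
move=> t; apply: cvgM; first exact: cvg_cst.
move: t; apply: continuous_big => [|i _]; first exact: mul_continuous.
exact: AC.
Qed.

Lemma continuous_constant_off0 (f : R -> R) : continuous f ->
  (forall t, t != 0 -> f t = f 1) -> f 0 = f 1.
Proof.
move=> fC f1; apply: (@cvg_unique _ (@norm_hausdorff R R^o) (f @ 0^')).
  exact: (cvg_within_filter _ (fC 0)).
apply: cvg_near_cst; near=> t; apply: f1; near: t; exact: nbhs_dnbhs_neq.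
Unshelve. all: by end_near. Qed.

(** Once [M 1 t - 1] is nilpotent, the binomial expansion of (M 1 t)^k has boundedly many terms, and
    its coefficients 'C(k, j) are polynomials in k. *)
Lemma progression_polynomial (z t : R) :
  exists p : {poly R}, forall k : nat, rho (z + k%:R * t) = p.[k%:R].
Proof.
have [m [x [F [[i [C FE]] Fx FG]]]] :=
  lagrange_basis (G := fun (ab : R * R) y => rho (ab.1 * y + ab.2)) rho_det0.
(* An empty basis forces rho = 0; the matrix ring below needs positive size. *)
case: m x F i C FE Fx FG => [|m] x F i C FE Fx FG.
  exists 0 => k; rewrite horner0; have := FG (1, 0) (z + k%:R * t).
  by rewrite big_ord0 /= mul1r addr0.
(* The span is stable under affine substitution, so [F l] after y |-> a y + b expands in the basis
   through its values at the nodes. *)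
have Faff a b l y : F l (a * y + b) = \sum_j F l (a * x j + b) * F j y.
  rewrite FE.
  under eq_bigr => k _.
    have := FG ((i k).1 * a, (i k).1 * b + (i k).2) y.
    rewrite /= -mulrA addrA -mulrDr => ->.
    over.
  under eq_bigr do rewrite mulr_sumr.
  rewrite exchange_big; apply: eq_bigr => j _ /=; rewrite (FE l) mulr_suml.
  by apply: eq_bigr => k _; rewrite mulrA; congr (_ * rho _ * _); ring.
(* The matrix of [f |-> (y |-> f (a * y + b))] in the Lagrange basis. *)
pose M a b : 'M[R]_m.+1 := \matrix_(j, l) F l (a * x j + b).
have MM a b c d : M a b *m M c d = M (c * a) (c * b + d).
  apply/matrixP => j l; rewrite !mxE.
  have -> : c * a * x j + (c * b + d) = c * (a * x j + b) + d by ring.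
  by rewrite Faff; apply: eq_bigr => k _; rewrite !mxE mulrC.
have M1 : M 1 0 = 1%:M.
  by apply/matrixP => j l; rewrite !mxE mul1r addr0 Fx eq_sym.
have detM a : a != 0 -> \det (M a 0) != 0.
  move=> a0; have : \det (M a 0) * \det (M a^-1 0) = 1.
    by rewrite -det_mulmx MM mulVf// mulr0 addr0 M1 det1.
  by apply: contra_eq_neq => ->; rewrite mul0r eq_sym oner_eq0.
have char_value u (w : R) : (char_poly (M 1 u)).[w] = \det (w%:M - M 1 u).
  rewrite /char_poly -[_.[w]]/(horner_eval w _) -det_map_mx; congr (\det _).
  apply/matrixP => j l; rewrite !mxE -[LHS]/(_.[w]) hornerD hornerN hornerC.
  by rewrite hornerMn hornerX.
have char_M : char_poly (M 1 t) = char_poly (M 1 0).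
  (* Translating by 1 and then dilating by s is dilating by s and then translating by s, so [M s 0]
     conjugates [M 1 s] to [M 1 1]. *)
  have conj w s : s != 0 -> \det (w%:M - M 1 s) = \det (w%:M - M 1 1).
    move=> s0; apply: (mulfI (detM _ s0)); rewrite [RHS]mulrC -!det_mulmx.
    congr (\det _); rewrite mulmxBr mulmxBl !MM !mulr1 !mul1r !addr0 add0r.
    by rewrite mul_mx_scalar mul_scalar_mx.
  have conj0 w : \det (w%:M - M 1 0) = \det (w%:M - M 1 1).
    apply: (@continuous_constant_off0 (fun s => \det (w%:M - M 1 s)));
      last exact: conj.
    apply: det_continuous => j l.
    have -> : (fun s => (w%:M - M 1 s) j l) =
      (fun s => w%:M j l - \sum_k C l k * rho ((i k).1 * (1 * x j + s) + (i k).2)).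
      by apply/funext => s; rewrite !mxE FE.
    move=> s; apply: cvgB; first exact: cvg_cst.
    move: s; apply: continuous_big => [|k _]; first exact: add_continuous.
    move=> s; apply: cvgM; first exact: cvg_cst.
    apply: (continuous_comp (f := fun s => (i k).1 * (1 * x j + s) + (i k).2));
      last exact: rhoC.
    apply: cvgD; last exact: cvg_cst.
    apply: cvgM; first exact: cvg_cst.
    by apply: cvgD; [exact: cvg_cst | exact: cvg_id].
  apply: poly_eq_nat => k; rewrite !char_value conj0.
  by have [->|/conj ->//] := eqVneq t 0; rewrite conj0.
(* The characteristic polynomial is that of the identity, (X - 1)^(m+1); Cayley-Hamilton
   concludes. *)
have nilp : (M 1 t - 1) ^+ m.+1 = 0.
  have <- : horner_mx (M 1 t) (char_poly (M 1 t)) = (M 1 t - 1) ^+ m.+1.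
    rewrite char_M M1 /char_poly /char_poly_mx map_scalar_mx -raddfB det_scalar.
    rewrite rmorphXn /=.
    by rewrite rmorphB /= horner_mx_X horner_mx_C.
  exact: Cayley_Hamilton.
pose v s : 'cV[R]_m.+1 := \col_j rho (x j + s).
have Mv s s' : M 1 s *m v s' = v (s + s').
  apply/colP => j; rewrite !mxE.
  have := FG (1, s') (x j + s); rewrite /= mul1r -addrA => ->.
  by apply: eq_bigr => l _; rewrite !mxE !mul1r mulrC.
have Mkv k s : (M 1 t) ^+ k *m v s = v (s + k%:R * t).
  elim: k s => [|k IH] s; first by rewrite expr0 mul1mx mul0r addr0.
  rewrite exprSr -mulmxA Mv IH; congr v; rewrite -[k.+1]addn1 natrD; ring.
(* The shift by the node [x ord0] makes entry 0 of the sampled vector equal to rho (z + k t). *)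
pose w j := ((M 1 t - 1) ^+ j *m v (z - x ord0)) ord0 0.
have [b bP] := choice (@binomial_poly R).
exists (\sum_(j < m.+1) w j *: b j) => k.
rewrite horner_sum.
have -> : rho (z + k%:R * t) = (v (z - x ord0 + k%:R * t)) ord0 0.
  by rewrite mxE; congr rho; ring.
rewrite -Mkv -[M 1 t](subrK 1) exprD1n mulmx_suml summxE.
under eq_bigr => j _ do rewrite -scaler_nat -scalemxAl mxE -/(w j).
under [RHS]eq_bigr => j _ do rewrite hornerZ bP mulrC.
(* One sum stops at k, the other at m. Surplus terms vanish, through the binomial or through
   nilpotency, so both extend to a common range. *)
have [ge0 gm] : (forall j, (k < j)%N -> 'C(k, j)%:R * w j = 0) /\
    (forall j, (m < j)%N -> 'C(k, j)%:R * w j = 0).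
  split=> j jk; first by rewrite bin_small// mul0r.
  by rewrite /w -(subnK jk) exprD nilp mulr0 mul0mx mxE mulr0.
rewrite (big_ord_widen _ (fun j => 'C(k, j)%:R * w j) (leq_addl m.+1 k.+1)).
rewrite (big_ord_widen _ (fun j => 'C(k, j)%:R * w j) (leq_addr k.+1 m.+1)).
rewrite [LHS]big_mkcond [RHS]big_mkcond; apply: eq_bigr => j _.
by case: (ltnP j k.+1) => [_|/ge0 C0]; case: (ltnP j m.+1) => [_|/gm w0] //=.
Qed.

End AffineInvariantSpace.

Theorem theorem2p1 (R : realType) (L : nat) (N : nat -> nat)
    (Omega : 'cV[R]_(N 0%N) -> Prop) (rho : R -> R) :
  (2 <= L)%N ->
  (forall l, (l <= L)%N -> (0 < N l)%N) ->
  nonempty_interior Omega ->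
  locally_lipschitz rho ->
  RNN_convex L rho Omega ->
  is_polynomial rho.
Proof.
case: L => [|[|L]]// _ Npos interior lip convex.
have rhoC := locally_lipschitz_continuous lip.
(* Nonconstant chains need two distinct values of [rho]; a constant [rho] is handled directly. *)
case: (pselect (exists u v, rho u != rho v)) => [nonconst|const].
  apply: polynomial_of_progressions => // z t.
  apply: (@progression_polynomial R rho #|parameter N L.+2|.+1) => // ab y.
  exact: (affine_family_det0 Npos interior lip convex _ _ nonconst (ltnSn _)).
exists (rho 0)%:P => x; rewrite hornerC.
by apply: contrapT => /eqP neq; apply: const; exists x, 0.
Qed.
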